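(* Let $G$ be a compact group and $X$ an almost Hausdorff $G$-space. Then $X$ is an almost proper $G$-space.
   Context: All topological groups and the spaces $X$ on which they act are assumed to be $T_0$ (hence topological groups are Hausdorff). A $G$-space is a topological space $X$ with a continuous map $G\times X\to X$, $(g,x)\mapsto g\cdot x$, such that $g\cdot(h\cdot x)=(gh)\cdot x$ and $e\cdot x=x$. A space is almost Hausdorff if every non-empty closed subset $A$ contains a non-empty, relatively open (in $A$) Hausdorff subset. A $G$-space $X$ is almost proper if every non-empty closed $G$-invariant subset $A$ of $X$ contains a non-empty, relatively open (in $A$), $G$-invariant Hausdorff subset $W$ such that $G$ acts properly on $W$, i.e. the map $G\times W\to W\times W$, $(g,x)\mapsto(g\cdot x,x)$, is proper (in Bourbaki's sense: continuous, closed, with quasi-compact fibres). *)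

(* Defs.v *)
From HB Require Import structures.
From mathcomp Require Import all_boot all_algebra all_classical topology.

Set Implicit Arguments.
Unset Strict Implicit.
Unset Printing Implicit Defensive.

Local Open Scope classical_set_scope.

HB.mixin Record Group_isTopologicalGroup G of Topological G & Group G := {
  mulg_continuous : continuous (fun p : G * G => (p.1 * p.2)%g);
  invg_continuous : continuous (fun g : G => (g^-1)%g)
}.

#[short(type="topologicalGroupType")]
HB.structure Definition TopologicalGroup :=
  {G of Topological G & Group G & Group_isTopologicalGroup G}.

(* A G-space is a topological space X together with an element of
   [topological_action G X]. *)
Record topological_action (G : topologicalGroupType) (X : topologicalType) := {
  act :> G -> X -> X;
  act_continuous : continuous (fun p : G * X => act p.1 p.2);
  actM : forall (g h : G) (x : X), act g (act h x) = act (g * h)%g x;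
  act1 : forall x : X, act 1%g x = x
}.

Definition relatively_open (X : topologicalType) (A W : set X) : Prop :=
  exists2 U : set X, open U & W = A `&` U.

(* [set X] coerces to the subtype [set_type], which carries the topology
   induced by X; [hausdorff_space W] for W : set X refers to it. *)
Definition almost_hausdorff (X : topologicalType) : Prop :=
  forall A : set X, closed A -> A !=set0 ->
    exists W : set X, [/\ W !=set0, relatively_open A W & hausdorff_space W].

Definition proper_map (X Y : topologicalType) (f : X -> Y) : Prop :=
  [/\ continuous f,
      forall C : set X, closed C -> closed (f @` C) &
      forall y : Y, compact (f @^-1` [set y])].

Definition proper_action (G : topologicalGroupType) (X : topologicalType)
    (a : topological_action G X) : Prop :=
  proper_map (fun p : G * X => (a p.1 p.2, p.2)).

Definition invariant_set (G : topologicalGroupType) (X : topologicalType)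
    (a : topological_action G X) (W : set X) : Prop :=
  forall (g : G) (x : X), W x -> W (a g x).

Section Restriction.
Variables (G : topologicalGroupType) (X : topologicalType).
Variables (a : topological_action G X) (W : set X).
Hypothesis invW : invariant_set a W.

Definition restr_act (g : G) (x : W) : W :=
  exist _ (a g (\val x)) (mem_set (invW g (set_mem (valP x)))).

Lemma restr_act_continuous : continuous (fun p : G * W => restr_act p.1 p.2).
Proof.
apply/continuousP => _ [U oU <-].
have -> : (fun p : G * W => restr_act p.1 p.2) @^-1` (set_val @^-1` U) =
          (fun p : G * W => a p.1 (set_val p.2)) @^-1` U by [].
apply: (proj1 (continuousP _) _ _ oU) => p.
apply: (@continuous_comp _ _ _ (fun p : G * W => (p.1, set_val p.2))
  (fun p : G * X => a p.1 p.2)); last exact: act_continuous.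
apply: cvg_pair; first exact: cvg_fst.
by apply: (cvg_comp _ _ cvg_snd); exact: (@initial_continuous W X set_val).
Qed.

Lemma restr_actM (g h : G) (x : W) :
  restr_act g (restr_act h x) = restr_act (g * h)%g x.
Proof. by apply: val_inj; exact: actM. Qed.

Lemma restr_act1 (x : W) : restr_act 1%g x = x.
Proof. by apply: val_inj; exact: act1. Qed.

Definition restr_action : topological_action G W :=
  Build_topological_action restr_act_continuous restr_actM restr_act1.

End Restriction.

Definition almost_proper (G : topologicalGroupType) (X : topologicalType)
    (a : topological_action G X) : Prop :=
  forall A : set X, closed A -> invariant_set a A -> A !=set0 ->
    exists (W : set X) (invW : invariant_set a W),
      [/\ W !=set0, relatively_open A W, hausdorff_space W &
          proper_action (restr_action invW)].

(* Main.v *)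
Require Import Defs.
From HB Require Import structures.
From mathcomp Require Import all_boot all_algebra all_classical topology.

Local Open Scope classical_set_scope.

(* Let V be a non-empty, relatively open Hausdorff subset of A. Since G is
   compact, finitely many translates of V cover the invariant set Y = GV' for a
   smaller non-empty open V' in V. A point of Y that is not separated from some
   other point of Y lies on the boundary of one of these translates; the
   boundaries are nowhere dense, so the points of Y that are separated from all
   others have a non-empty interior W, which is Hausdorff and invariant. A
   compact group acts properly on the Hausdorff space W. *)

(** The cluster condition says that neighbourhoods of [x] and [y] in [X] never have disjoint traces
    on [W]. Filters on [X] allow inseparability in different subsets to be compared without passing
    between subtypes. *)
Lemma hausdorff_subspaceP (X : topologicalType) (W : set X) :
  hausdorff_space W <->
  forall x y, W x -> W y -> cluster (within W (nbhs x)) y -> x = y.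
Proof.
split=> [hW x y Wx Wy xy|hW x y xy].
  pose x' : W := exist _ x (mem_set Wx); pose y' : W := exist _ y (mem_set Wy).
  suff /(congr1 set_val) : x' = y' by [].
  apply: hW => A B; rewrite !nbhsE.
  move=> [_ [[U oU <-] Ux] UA] [_ [[V oV <-] Vy] VB].
  have WU : within W (nbhs x) (W `&` U).
    by apply: filterS (open_nbhs_nbhs (conj oU Ux)) => z Uz Wz.
  have [z [[Wz Uz] Vz]] := xy _ _ WU (open_nbhs_nbhs (conj oV Vy)).
  by exists (exist _ z (mem_set Wz)); split; [apply: UA|apply: VB].
apply: val_inj; apply: hW; [exact: set_valP|exact: set_valP|].
move=> A B xA yB.
have xA' := @initial_continuous W X set_val x _ xA.
have yB' := @initial_continuous W X set_val y _ yB.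
have [z [Az Bz]] := xy _ _ xA' yB'.
by exists (set_val z); split=> //; apply: Az; exact: set_valP.
Qed.

Lemma cluster_withinS (X : topologicalType) (A B : set X) (x y : X) :
  A `<=` B -> cluster (within A (nbhs x)) y -> cluster (within B (nbhs x)) y.
Proof.
move=> AB xy P Q xP yQ; apply: xy => //.
by apply: (@filterS _ (nbhs x) _ _ _ _ xP) => z Pz /AB /Pz.
Qed.

(** Inseparability is local: near [x] the sets [A] and [A ∩ U] coincide. *)
Lemma cluster_within_setI (X : topologicalType) (A U : set X) (x y : X) :
  nbhs x U ->
  cluster (within A (nbhs x)) y -> cluster (within (A `&` U) (nbhs x)) y.
Proof.
move=> xU xy P Q xP yQ; apply: xy => //.
by apply: (@filterS2 _ (nbhs x) _ _ _ _ _ xU xP) => z Uz Pz Az; apply: Pz.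
Qed.

Lemma compact_finite_cover (X : topologicalType) (I : choiceType)
    (f : I -> set X) :
  compact [set: X] -> (forall i, open (f i)) -> (forall x, exists i, f i x) ->
  exists s : seq I, forall x, exists2 i, i \in s & f i x.
Proof.
move=> cX fo fX.
(* [F] is the filter of properties that hold for all sufficiently large finite lists. Near-covering
   compactness along [F] yields one list that serves every point. *)
pose F : set_system (seq I) :=
  [set S | exists t : seq I, forall s : seq I, {subset t <= s} -> S s].
have FF : Filter F.
  split.
  - by exists [::].
  - move=> P Q [t Pt] [u Qu]; exists (t ++ u) => s tus; split.
      by apply: Pt => i it; apply: tus; rewrite mem_cat it.
    by apply: Qu => i iu; apply: tus; rewrite mem_cat iu orbT.
  - by move=> P Q PQ [t Pt]; exists t => s /Pt /PQ.
have cov (x : X) : setT x ->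
    \forall x' \near x & s \near F, exists2 i, i \in s & f i x'.
  move=> _; have [i fix_] := fX x.
  exists (f i, [set s : seq I | i \in s]).
    split=> /=; first exact: (open_nbhs_nbhs (conj (fo i) fix_)).
    by exists [:: i] => s; apply; rewrite mem_head.
  by move=> [y s] [/= fy si]; exists i.
have [t tP] := proj1 (compact_near_coveringP _) cX _ F
  (fun s x => exists2 i, i \in s & f i x) FF cov.
by exists t => x; exact: tP.
Qed.

Section Actions.
Variables (G : topologicalGroupType) (X : topologicalType).
Variable a : topological_action G X.

Lemma mulgl_continuous (g : G) : continuous (fun h : G => (g * h)%g).
Proof.
move=> h; apply: (@continuous_comp _ _ _ (fun h : G => (g, h))
  (fun p : G * G => (p.1 * p.2)%g)); last exact: mulg_continuous.
by apply: cvg_pair; [exact: cvg_cst|exact: cvg_id].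
Qed.

Lemma actl_continuous (g : G) : continuous (a g).
Proof.
move=> x; apply: (@continuous_comp _ _ _ (fun x : X => (g, x))
  (fun p : G * X => a p.1 p.2)); last exact: act_continuous.
by apply: cvg_pair; [exact: cvg_cst|exact: cvg_id].
Qed.

Lemma actr_continuous (x : X) : continuous (fun g => a g x).
Proof.
move=> g; apply: (@continuous_comp _ _ _ (fun g : G => (g, x))
  (fun p : G * X => a p.1 p.2)); last exact: act_continuous.
by apply: cvg_pair; [exact: cvg_id|exact: cvg_cst].
Qed.

Lemma actK (g : G) : cancel (a g) (a g^-1%g).
Proof. by move=> x; rewrite actM mulVg act1. Qed.

Lemma actKV (g : G) : cancel (a g^-1%g) (a g).
Proof. by move=> x; rewrite actM mulgV act1. Qed.

Lemma open_preimage_act (g : G) (U : set X) : open U -> open (a g @^-1` U).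
Proof. by apply: open_comp => x _; exact: actl_continuous. Qed.

Lemma cluster_within_act (A : set X) (g : G) (x y : X) : invariant_set a A ->
  cluster (within A (nbhs x)) y -> cluster (within A (nbhs (a g x))) (a g y).
Proof.
move=> iA xy P Q xP yQ.
have xP' : within A (nbhs x) (a g @^-1` P).
  by apply: (@filterS _ (nbhs x) _ _ _ _ (actl_continuous g x _ xP)) => z Pz
      /(iA g) /Pz.
have [z [Pz Qz]] := xy _ _ xP' (actl_continuous g y _ yQ).
by exists (a g z).
Qed.

(** Closedness is a tube argument: a neighbourhood of a point outside the image of [C], found near
    each single [g], can be chosen uniformly in [g] because [G] is compact. The fibre over [(y, x)]
    is a copy of the closed subset of [G] carrying [x] to [y]. *)
Lemma compact_proper_action :
  compact [set: G] -> hausdorff_space X -> proper_action a.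
Proof.
move=> cG hX; pose f (p : G * X) := (a p.1 p.2, p.2).
have cf : continuous f.
  by move=> p; apply: cvg_pair; [exact: act_continuous|exact: cvg_snd].
split=> //.
- move=> C cC; rewrite -openC openE => -[y x] nC; rewrite /interior.
  have cov (g : G) : setT g -> \forall g' \near g & q \near nbhs (y, x),
      ~ (C (g', q.2) /\ a g' q.2 = q.1).
    (* If [g] carries [x] to [y], then [(g, x)] lies in the open complement of [C]; otherwise
       disjoint neighbourhoods of [a g x] and [y] exclude the equation nearby. *)
    move=> _; have [gxy|/eqP gxy] := pselect (a g x = y).
      have /= [] := (open_nbhs_nbhs (conj (closed_openC cC) _) : nbhs (g, x) _).
        by move=> Cgx; apply: nC; exists (g, x) => //; rewrite /f /= gxy.
      move=> [P Q] [/= gP xQ] PQ; exists (P, snd @^-1` Q).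
        by split=> //; exists (setT, Q) => [|[? ?] []//]; split=> //; exact: filterT.
      by move=> [g' [y' x']] [/= Pg Qx] [Cgx _]; exact: (PQ (g', x')).
    move: hX; rewrite open_hausdorff => /(_ _ _ gxy)[[U V]].
    move=> [/= /set_mem Ugx /set_mem Vy] [oU oV /eqP UV].
    have [[P Q] [/= gP xQ] PQ] :=
      @act_continuous _ _ a (g, x) _ (open_nbhs_nbhs (conj oU Ugx)).
    exists (P, V `*` Q).
      by split=> //; exists (V, Q) => //; split=> //; exact: open_nbhs_nbhs.
    move=> [g' [y' x']] [/= Pg [/= Vy' Qx]] [_ e].
    have : (U `&` V) y' by split=> //; rewrite -e; exact: (PQ (g', x')).
    by rewrite UV.
  have := proj1 (compact_near_coveringP _) cG _ (nbhs (y, x))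
    (fun q g => ~ (C (g, q.2) /\ a g q.2 = q.1)) (nbhs_filter _) cov.
  apply: filterS => -[y' x'] H /= [[g z] Cz] [eqy eqz].
  by apply: (H g) => //=; rewrite -eqz.
- move=> -[y x].
  have eqf : f @^-1` [set (y, x)] =
      (fun g => (g, x)) @` ([set: G] `&` (fun g => a g x) @^-1` [set y]).
    apply/seteqP; split=> [[g z] [/= <- <-]|_ [g [_ /= <-] <-]] //.
    by exists g.
  rewrite eqf; apply: continuous_compact.
    apply: continuous_subspaceT => g.
    by apply: cvg_pair; [exact: cvg_id|exact: cvg_cst].
  apply: compact_closedI => //; apply: preimage_closed.
    by move=> g _; exact: actr_continuous.
  exact/accessible_closed_set1/hausdorff_accessible.
Qed.

(** This finds a piece of [A] that avoids the boundaries of finitely many translates of [V]. For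
    each [g] in turn, either [O] can be cut down to the translate or [A ∩ O] already misses it, and
    both alternatives survive further shrinking. *)
Lemma open_dichotomy (A V : set X) (s : seq G) (O : set X) :
  open V -> open O -> A `&` O !=set0 ->
  exists O' : set X, [/\ open O', O' `<=` O, A `&` O' !=set0 &
    forall g, g \in s -> O' `<=` a g @^-1` V \/
                         A `&` O' `&` a g @^-1` V = set0].
Proof.
move=> oV; elim: s O => [|g s IH] O oO AO; first by exists O; split.
have [[x [[Ax Ox] gx]]|/set0P/negP/negPn/eqP A0] :=
  pselect (A `&` O `&` a g @^-1` V !=set0).
  have oOg : open (O `&` a g @^-1` V).
    by apply: openI => //; exact: open_preimage_act.
  have [|O' [oO' O'O AO' H]] := IH _ oOg; first by exists x.
  exists O'; split=> // [z /O'O[]//|h]; rewrite inE => /predU1P[->|/H//].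
  by left=> z /O'O[].
have [O' [oO' O'O AO' H]] := IH _ oO AO.
exists O'; split=> // h; rewrite inE => /predU1P[->|/H//].
by right; rewrite -subset0 -A0 => z [[Az /O'O Oz] gz].
Qed.

Lemma exists_invariant_hausdorff (A U : set X) :
  compact [set: G] -> invariant_set a A ->
  open U -> A `&` U !=set0 -> hausdorff_space (A `&` U) ->
  exists W : set X, [/\ invariant_set a W, W !=set0, relatively_open A W &
    hausdorff_space W].
Proof.
move=> cG iA oU [x0 [Ax0 Ux0]] /hausdorff_subspaceP hAU.
(* By continuity at [(1, x0)], [P] moves [Q] into [U]; [Q°] is the smaller set whose translates form
   [Y]. *)
have [[P Q] [/= P1 Qx0] PQ] : nbhs (1%g : G, x0) [set p | U (a p.1 p.2)].
  by apply: act_continuous; rewrite /= act1; exact: open_nbhs_nbhs.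
have [s sP] : exists s : seq G, forall h, exists2 g, g \in s & P° (g * h)%g.
  apply: (@compact_finite_cover G G (fun g h => P° (g * h)%g)) => // [g|h].
    apply: (@open_comp _ _ (fun h => (g * h)%g)); last exact: open_interior.
    by move=> h _; exact: mulgl_continuous.
  by exists h^-1%g; rewrite mulVg.
pose Y := \bigcup_g (a g @^-1` Q°).
(* If [a g z] lies in [Q°], choose [k] in [s] with [k * g^-1] in [P°]; then [a k z] lies in [U].
   Thus finitely many translates of [U] cover [Y]. *)
have YU z : Y z -> exists2 g, g \in s & U (a g z).
  move=> [g _ Qz]; have [k ks Pk] := sP g^-1%g; exists k => //.
  have /= := PQ (_, _) (conj (interior_subset Pk) (interior_subset Qz)).
  by rewrite -actM actK.
have iY : invariant_set a Y.
  by move=> g z [k _ Qz]; exists (k * g^-1)%g => //=; rewrite -actM actK.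
(* The guard [A y] keeps all of [Y] outside [A] in [T]. As [Y] is open, the interior of [T] in [X]
   then cuts out on [A] the relative interior of [A ∩ T]. *)
pose T := Y `&` [set y | A y -> forall z, A z -> Y z ->
  cluster (within A (nbhs y)) z -> y = z].
have iT : invariant_set a T.
  move=> g y [Yy Ty]; split=> [|Agy z Az Yz yz]; first exact: iY.
  rewrite -[RHS](actKV g); congr (a g _); apply: Ty.
  - by rewrite -(actK g y); exact: iA.
  - exact: iA.
  - exact: iY.
  - by have := cluster_within_act _ g^-1%g _ _ iA yz; rewrite actK.
exists (A `&` T°); split.
- move=> g x [Ax Tx]; split; first exact: iA.
  have Tgx : nbhs (a g^-1%g (a g x)) T by rewrite actK.
  by apply: (@filterS _ (nbhs (a g x)) _ _ _ _
    (actl_continuous g^-1%g (a g x) _ Tgx)) => z /(iT g); rewrite actKV.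
- have AQ : A `&` Q° !=set0 by exists x0.
  have [O [oO OQ [p [Ap Op]] Os]] :=
    open_dichotomy _ _ s _ oU (open_interior Q) AQ.
  exists p; split=> //; apply: filterS (open_nbhs_nbhs (conj oO Op)) => y Oy.
  split=> [|Ay z Az Yz yz]; first by exists 1%g => //=; rewrite act1; exact: OQ.
  (* Either [k] moves both [y] and [z] into the Hausdorff set [A ∩ U], where inseparable points are
     equal, or [A ∩ O] and the [k]-preimage of [U] separate [y] from [z], a contradiction. *)
  have [k ks Ukz] := YU z Yz; have [OU|OU] := Os k ks.
    apply: (can_inj (actK k)); apply: hAU; [by split; [exact: iA|exact: OU]|
      by split=> //; exact: iA|].
    apply: cluster_within_setI; last exact: cluster_within_act.
    by apply: open_nbhs_nbhs; split=> //; exact: OU.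
  have yO : within A (nbhs y) (A `&` O).
    by apply: (@filterS _ (nbhs y) _ _ _ _ (open_nbhs_nbhs (conj oO Oy))).
  have zU : nbhs z (a k @^-1` U).
    by apply: open_nbhs_nbhs; split=> //; exact: open_preimage_act.
  by have := yz _ _ yO zU; rewrite OU => -[].
- by exists T° => //; exact: open_interior.
(* Points inseparable in [A ∩ T°] are inseparable in the larger set [A], and membership of [x] in
   [T] forces equality. *)
- apply/hausdorff_subspaceP => x y [Ax Tx] [Ay Ty] xy.
  have [_ sx] := interior_subset Tx; have [Yy _] := interior_subset Ty.
  by apply: sx => //; apply: cluster_withinS xy => z [].
Qed.

End Actions.

Theorem mainTheorem4 (G : topologicalGroupType) (X : topologicalType)
    (a : topological_action G X) :
  kolmogorov_space G -> kolmogorov_space X ->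
  compact [set: G] -> almost_hausdorff X ->
  almost_proper a.
Proof.
move=> _ _ cG ahX A cA iA A0; have [V [V0 [U oU VE] hV]] := ahX A cA A0.
move: V0 hV; rewrite VE => V0 hV.
have [W [iW W0 oW hW]] := exists_invariant_hausdorff _ _ a _ _ cG iA oU V0 hV.
by exists W, iW; split=> //; exact: compact_proper_action.
Qed.
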